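(* Let $G_1,G_2:(\mathbb{R}^M,0)\to(\mathbb{R}^N,0)$ be analytic map germs that are $C^\infty$-$\mathcal{A}$-equivalent. If $G_1$ is tame with respect to a proper function $\rho_1$, then there exists another proper function $\rho_2$ such that $G_2$ is tame with respect to $\rho_2$.
   Context: $M\ge N\ge 2$; map germs are non-constant and all sets are considered as germs at the origin. $C^\infty$-$\mathcal{A}$-equivalence means that there are $C^\infty$ diffeomorphism germs $\phi$ of $(\mathbb{R}^M,0)$ and $\psi$ of $(\mathbb{R}^N,0)$ with $G_2=\psi\circ G_1\circ\phi$. A ''proper function'' here is a smooth nonnegative proper function $\rho:U\to\mathbb{R}_{\ge0}$ defined on an open neighbourhood $U$ of $0\in\mathbb{R}^M$ and vanishing only at the origin. For a map germ $G:(\mathbb{R}^M,0)\to(\mathbb{R}^N,0)$, put $V_G=G^{-1}(0)$; $M_\rho(G)=\mathrm{Sing}(G,\rho)$ is the set of points where the Jacobian matrix of $(G,\rho)$ does not have maximal rank (rank less than $N+1$). $G$ is tame with respect to $\rho$ if $\overline{M_\rho(G)\setminus V_G}\cap V_G\subseteq\{0\}$ as set germs at the origin. *)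

(* Defs.v *)
From mathcomp Require Export all_boot all_order all_algebra.
From mathcomp Require Export all_classical all_reals all_analysis.
From mathcomp Require Export summability(totally, partial_sum).
Export numFieldNormedType.Exports.

Set Implicit Arguments.
Unset Strict Implicit.
Unset Printing Implicit Defensive.

Import Order.TTheory GRing.Theory Num.Theory.

Local Open Scope classical_set_scope.
Local Open Scope ring_scope.

(* Germs at 0 are given by total functions; every predicate on germs below
   depends only on the values of these functions near 0. *)

(* To be used on an open set U, where 'D_v f only depends on f on U. *)
Fixpoint Ck_on (R : realType) (V W : normedModType R) (k : nat) (U : set V)
    (f : V -> W) : Prop :=
  match k with
  | 0%N => forall x, U x -> {for x, continuous f}
  | k'.+1 => (forall x, U x -> differentiable f x) /\
             (forall v : V, Ck_on k' U (fun x => 'D_v f x))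
  end.

Definition smooth_on (R : realType) (V W : normedModType R) (U : set V)
    (f : V -> W) : Prop :=
  forall k, Ck_on k U f.

Definition smooth_germ (R : realType) (V W : normedModType R) (f : V -> W) :
    Prop :=
  exists U : set V, [/\ open U, U 0 & smooth_on U f].

Definition diffeo_germ (R : realType) (V : normedModType R) (phi : V -> V) :
    Prop :=
  [/\ phi 0 = 0, smooth_germ phi &
    exists phi' : V -> V, [/\ smooth_germ phi',
      \forall x \near (0 : V), phi' (phi x) = x &
      \forall y \near (0 : V), phi (phi' y) = y]].

Definition monomial_at (R : realType) (M : nat) (a x : 'rV[R]_M)
    (alpha : {ffun 'I_M -> nat}) : R :=
  \prod_(i < M) ((x - a) 0 i) ^+ alpha i.

(* The limit along [totally] is that of the net of finite partial sums, i.e.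
   the multi-indexed power series converges unconditionally to G x. *)
Definition analytic_at (R : realType) (M N : nat) (G : 'rV[R]_M -> 'rV[R]_N)
    (a : 'rV[R]_M) : Prop :=
  exists c : {ffun 'I_M -> nat} -> 'rV[R]_N,
    \forall x \near a,
      partial_sum (fun alpha => monomial_at a x alpha *: c alpha) @ totally
        --> G x.

Definition analytic_map_germ (R : realType) (M N : nat)
    (G : 'rV[R]_M -> 'rV[R]_N) : Prop :=
  G 0 = 0 /\ \forall a \near (0 : 'rV[R]_M), analytic_at G a.

Definition constant_germ (R : realType) (M N : nat)
    (G : 'rV[R]_M -> 'rV[R]_N) : Prop :=
  \forall x \near (0 : 'rV[R]_M), G x = G 0.

Definition smooth_A_equivalent (R : realType) (M N : nat)
    (G1 G2 : 'rV[R]_M -> 'rV[R]_N) : Prop :=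
  exists (phi : 'rV[R]_M -> 'rV[R]_M) (psi : 'rV[R]_N -> 'rV[R]_N),
    [/\ diffeo_germ phi, diffeo_germ psi &
      \forall x \near (0 : 'rV[R]_M), G2 x = psi (G1 (phi x))].

(* rho : U -> [0, +oo[; its values outside U are irrelevant. *)
Definition proper_function (R : realType) (M : nat) (U : set 'rV[R]_M)
    (rho : 'rV[R]_M -> R) : Prop :=
  [/\ open U /\ U 0, smooth_on U rho, forall x, U x -> 0 <= rho x,
    forall K : set R, K `<=` [set t | 0 <= t] -> compact K ->
      compact (U `&` rho @^-1` K) &
    forall x, U x -> (rho x = 0 <-> x = 0)].

Definition zero_locus (R : realType) (M N : nat)
    (G : 'rV[R]_M -> 'rV[R]_N) : set 'rV[R]_M :=
  [set x | G x = 0].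

Definition map_with (R : realType) (M N : nat) (G : 'rV[R]_M -> 'rV[R]_N)
    (rho : 'rV[R]_M -> R) (x : 'rV[R]_M) : 'rV[R]_(N + 1) :=
  row_mx (G x) (rho x)%:M.

(* ['J f x] acts on row vectors, so it is the transpose of the usual Jacobian
   matrix. *)
Definition milnor_set (R : realType) (M N : nat) (G : 'rV[R]_M -> 'rV[R]_N)
    (rho : 'rV[R]_M -> R) : set 'rV[R]_M :=
  [set x | (\rank ('J (map_with G rho) x) < N + 1)%N].

(* The intersection of the closure of a set with an open neighbourhood of 0
   only depends on the germ of that set along the neighbourhood, so the closure
   may be taken in the whole space. *)
Definition tame (R : realType) (M N : nat) (G : 'rV[R]_M -> 'rV[R]_N)
    (rho : 'rV[R]_M -> R) : Prop :=
  \forall x \near (0 : 'rV[R]_M),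
    (closure (milnor_set G rho `\` zero_locus G) `&` zero_locus G) x ->
    x = 0.

(* Main.v *)
(* Write [G2 = psi o G1 o phi] near 0 and take for [rho2] the pullback
   [rho1 o phi], made proper again by composing with [t |-> t / (e - t)], where
   [e] is so small that [{rho1 < e}] lies in a neighbourhood of 0 on which [phi]
   is invertible. Then [(G2, rho2)] is obtained from [(G1, rho1)] by
   diffeomorphisms of the source and of the target, so that [phi] maps the
   singular set of [(G2, rho2)] into that of [(G1, rho1)], and [V_G2] into
   [V_G1]. The germ of [psi] at 0 can be inverted after [G1] because an analytic
   germ is continuous. *)
Require Import Defs.
From mathcomp Require Import finmap.

Set Implicit Arguments.
Unset Strict Implicit.
Unset Printing Implicit Defensive.

Import Order.TTheory GRing.Theory Num.Theory.

Local Open Scope classical_set_scope.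
Local Open Scope ring_scope.

(** * Calculus of [C^k] maps *)

Lemma near_eq_differentiable (R : numFieldType) (V W : normedModType R)
    (f g : V -> W) (a : V) :
  {near a, f =1 g} -> differentiable f a ->
  differentiable g a /\ 'd g a = 'd f a :> (V -> W).
Proof.
move=> fg df.
have dc := diff_continuous df.
have gE : g \o shift a = cst (g a) + 'd f a +o_ 0 id.
  have fg0 : \forall y \near 0, f (y + a) = g (y + a).
    by move: fg; rewrite (near_shift 0 a) subr0.
  apply/eqaddoP => e e0.
  have /eqaddoP/(_ e e0) := diff_locally df.
  apply: filter_app; near=> y.
  by rewrite !fctE (near fg0 y)// (nbhs_singleton fg).
have dg : 'd g a = 'd f a :> (V -> W) by apply: diff_unique.
by split=> //; apply/diff_locallyP; rewrite dg; split.
Unshelve. all: by end_near. Qed.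

Lemma differentiable_rV (R : numFieldType) (V : normedModType R) n
    (f : V -> 'rV[R]_n) (a : V) :
  (forall j, differentiable (fun x => f x 0 j) a) -> differentiable f a.
Proof.
move=> df.
have -> : f = \sum_(j < n) (fun x => f x 0 j *: delta_mx 0 j).
  by apply/funext => x; rewrite [LHS]row_sum_delta fct_sumE.
by apply: differentiable_sum => j; exact: differentiableZl.
Qed.

Lemma derive_coord (R : realType) (V : normedModType R) n
    (f : V -> 'rV[R]_n) (a v : V) j : differentiable f a ->
  'D_v (fun x => f x 0 j) a = ('D_v f a) 0 j.
Proof. by move=> df; rewrite derive_mx ?mxE//; exact: diff_derivable. Qed.

Section Ck.
Context {R : realType} {V : normedModType R}.
Implicit Types (U : set V) (k : nat).

Lemma Ck_onW (W : normedModType R) k U (f : V -> W) :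
  Ck_on k.+1 U f -> Ck_on k U f.
Proof.
elim: k f => [|k IH] f [df Df].
  by move=> x /df; exact: differentiable_continuous.
by split=> // v; exact: IH.
Qed.

(** Differentiation rules hold only at the points of [U], while derivatives are total functions. As
    [U] is open, values on [U] determine derivatives there, so the inductions below may replace a
    derivative by a formula valid on [U]. *)
Lemma Ck_on_eq (W : normedModType R) k U (f g : V -> W) :
  open U -> (forall x, U x -> f x = g x) -> Ck_on k U f -> Ck_on k U g.
Proof.
move=> oU; elim: k f g => [|k IH] f g fg.
  move=> fc x Ux; rewrite /prop_for /continuous_at -(fg _ Ux).
  apply: cvg_trans (fc x Ux); apply: near_eq_cvg.
  by near=> y; apply: fg; near: y; exact: open_nbhs_nbhs.
have nfg x : U x -> {near x, f =1 g}.
  by move=> Ux; near=> y; apply: fg; near: y; exact: open_nbhs_nbhs.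
move=> [df Df]; split=> [x Ux|v].
  by have [] := near_eq_differentiable (nfg x Ux) (df x Ux).
by apply: IH (Df v) => x Ux; exact: near_eq_derive (nfg x Ux).
Unshelve. all: by end_near. Qed.

Lemma Ck_on_sub (W : normedModType R) k U U' (f : V -> W) :
  U' `<=` U -> Ck_on k U f -> Ck_on k U' f.
Proof.
move=> UU'; elim: k f => [|k IH] f; first by move=> fc x /UU'; exact: fc.
by move=> [df Df]; split=> [x /UU' /df//|v]; exact: IH (Df v).
Qed.

Lemma Ck_on_cst (W : normedModType R) k U (a : W) : Ck_on k U (fun=> a).
Proof.
elim: k a => [|k IH] a; first by move=> x _; exact: cst_continuous.
split=> [x _|v]; first exact: differentiable_cst.
by under eq_fun do rewrite derive_cst.
Qed.

Lemma Ck_onD (W : normedModType R) k U (f g : V -> W) :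
  open U -> Ck_on k U f -> Ck_on k U g -> Ck_on k U (fun x => f x + g x).
Proof.
move=> oU; elim: k f g => [|k IH] f g.
  by move=> fc gc x Ux; apply: continuousD; [exact: fc|exact: gc].
move=> [df Df] [dg Dg]; split=> [x Ux|v].
  by apply: differentiableD; [exact: df|exact: dg].
apply: Ck_on_eq (IH _ _ (Df v) (Dg v)) => // x Ux.
by rewrite -deriveD//; apply: diff_derivable; [exact: df|exact: dg].
Qed.

Lemma Ck_on_sum (W : normedModType R) k U n (f : 'I_n -> V -> W) :
  open U -> (forall i, Ck_on k U (f i)) ->
  Ck_on k U (fun x => \sum_(i < n) f i x).
Proof.
move=> oU; elim: n f => [|n IH] f Cf.
  by under eq_fun do rewrite big_ord0; exact: Ck_on_cst.
under eq_fun do rewrite big_ord_recl.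
by apply: Ck_onD => //; exact: IH.
Qed.

Lemma Ck_onM k U (f g : V -> R) :
  open U -> Ck_on k U f -> Ck_on k U g -> Ck_on k U (fun x => f x * g x).
Proof.
move=> oU; elim: k f g => [|k IH] f g.
  by move=> fc gc x Ux; apply: continuousM; [exact: fc|exact: gc].
move=> Cf Cg; have [df Df] := Cf; have [dg Dg] := Cg; split=> [x Ux|v].
  by apply: differentiableM; [exact: df|exact: dg].
have := Ck_onD oU (IH _ _ (Ck_onW Cf) (Dg v)) (IH _ _ (Ck_onW Cg) (Df v)).
apply: Ck_on_eq => // x Ux.
by rewrite -[LHS]deriveM//; apply: diff_derivable; [exact: df|exact: dg].
Qed.

Lemma Ck_onV k U (f : V -> R) : open U -> (forall x, U x -> f x != 0) ->
  Ck_on k U f -> Ck_on k U (fun x => (f x)^-1).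
Proof.
move=> oU f0; elim: k => [|k IH].
  by move=> fc x Ux; apply: continuousV; [exact: f0|exact: fc].
move=> Cf; have [df Df] := Cf; split=> [x Ux|v].
  by apply: differentiableV; [exact: df|exact: f0].
have CV := IH (Ck_onW Cf).
have CN : Ck_on k U (fun=> -1 : R) by exact: Ck_on_cst.
have := Ck_onM oU (Ck_onM oU CN (Ck_onM oU CV CV)) (Df v).
apply: Ck_on_eq => // x Ux.
rewrite deriveV ?f0//; last exact/diff_derivable/df.
by rewrite mulN1r -expr2 exprVn.
Qed.

Lemma Ck_on_coord k U n (f : V -> 'rV[R]_n) j : open U -> Ck_on k U f ->
  Ck_on k U (fun x => f x 0 j).
Proof.
move=> oU; elim: k f => [|k IH] f.
  move=> fc x Ux.
  apply: (@continuous_comp _ _ _ f (fun y : 'rV[R]_n => y 0 j)).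
    exact: fc.
  exact: coord_continuous.
move=> [df Df]; split=> [x Ux|v].
  exact: differentiable_comp (df x Ux) (differentiable_coord (f x) 0 j).
apply: Ck_on_eq (IH _ (Df v)) => // x Ux.
by rewrite derive_coord//; exact: df.
Qed.

(** By the chain rule, the derivative of [g \o f] along [v] is the sum over [i] of the [i]-th
    coordinate of ['D_v f] times the [i]-th partial derivative of [g] composed with [f]; the
    induction hypothesis applies to these composites. *)
Lemma Ck_on_comp n k U (U' : set 'rV[R]_n) (f : V -> 'rV[R]_n)
    (g : 'rV[R]_n -> R) :
  open U -> (forall x, U x -> U' (f x)) -> Ck_on k U f -> Ck_on k U' g ->
  Ck_on k U (g \o f).
Proof.
move=> oU fU; elim: k f g fU => [|k IH] f g fU.
  by move=> fc gc x Ux; apply: continuous_comp; [exact: fc|exact/gc/fU].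
move=> Cf; have [df Df] := Cf; move=> [dg Dg]; split=> [x Ux|v].
  by apply: differentiable_comp; [exact: df|exact/dg/fU].
have : Ck_on k U (fun x => \sum_(i < n)
    ('D_v f x) 0 i * ((fun y => 'D_(delta_mx 0 i) g y) \o f) x).
  apply: Ck_on_sum => // i; apply: Ck_onM => //.
    exact: Ck_on_coord (Df v).
  by apply: IH (Ck_onW Cf) (Dg _).
apply: Ck_on_eq => // x Ux.
have dfx := df x Ux; have dgx := dg _ (fU _ Ux).
rewrite [RHS]deriveE; last exact: differentiable_comp.
rewrite diff_comp//= -(deriveE v dfx) [in RHS](row_sum_delta ('D_v f x)).
by rewrite linear_sum; apply: eq_bigr => i _; rewrite linearZ /= -deriveE.
Qed.

End Ck.

(** * Continuity of analytic germs *)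

#[local] Existing Instance summability.totally_filter.

Lemma partial_sumE (I : choiceType) (V : zmodType) (u : I -> V)
  (A : {fset I}) : partial_sum u A = \sum_(i <- A) u i.
Proof. by rewrite /partial_sum big_seq_fsetE. Qed.

(** By the Cauchy criterion, finite sums that avoid a fixed finite set [A0] are at most 2 in
    absolute value; applied separately to the nonnegative and to the negative terms, this bounds the
    sums of absolute values. *)
Lemma totally_cvg_abs_bounded (R : realType) (I : choiceType) (u : I -> R)
    (l : R) : partial_sum u @ totally --> l ->
  exists K, forall A : {fset I}, \sum_(i <- A) `|u i| <= K.
Proof.
move=> /cvgrPdist_lt/(_ 1 ltr01)[A0 _ A0l].
have {}A0l A : (A0 `<=` A)%fset -> `|l - \sum_(i <- A) u i| < 1.
  by move=> A0A; rewrite -partial_sumE; exact: A0l.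
have tail (B : {fset I}) (P : pred I) :
    `|\sum_(i <- B | (i \notin A0) && P i) u i| <= 2.
  (* [A] adjoins the selected indices of [B] to [A0], so the sum in question is the difference of
     two partial sums, each within 1 of [l]. *)
  pose A := (A0 `|` [fset i in B | P i])%fset.
  have AE : \sum_(i <- A) u i = \sum_(i <- A0) u i +
      \sum_(i <- B | (i \notin A0) && P i) u i.
    rewrite (bigID (mem A0))/=; congr (_ + _).
      apply: eq_fbig_cond => // i; rewrite !inE/=.
      by case: (i \in A0); rewrite ?andbT ?andbF ?orbT.
    apply: eq_fbig_cond => // i; rewrite !inE/=.
    by case: (i \in A0); rewrite /= ?andbT ?andbF.
  have -> : \sum_(i <- B | (i \notin A0) && P i) u i =
      (l - \sum_(i <- A0) u i) - (l - \sum_(i <- A) u i).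
    by rewrite AE opprB -[X in _ + X]addrA subrKA addrCA subrr addr0.
  rewrite (le_trans (ler_normB _ _))// (_ : 2 = 1 + 1)// lerD// ltW// A0l//.
  exact: fsubsetUl.
exists (\sum_(i <- A0) `|u i| + (2 + 2)) => B.
rewrite (bigID (mem A0))/= lerD//.
  rewrite [leRHS](bigID (mem B))/= -[leLHS]addr0 lerD// ?sumr_ge0//.
  rewrite le_eqVlt; apply/orP; left; apply/eqP.
  by apply: eq_fbig_cond => // i; rewrite !inE/= andbC.
rewrite (bigID (fun i => 0 <= u i))/= lerD//.
  rewrite (le_trans _ (tail B (fun i => 0 <= u i)))//.
  rewrite (eq_bigr u) ?ler_norm// => i /andP[_ ui].
  by rewrite ger0_norm.
rewrite (le_trans _ (tail B (fun i => ~~ (0 <= u i))))//.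
rewrite (eq_bigr (fun i => - u i)).
  by rewrite sumrN -[leRHS]normrN ler_norm.
by move=> i /andP[_]; rewrite -ltNge => ui; rewrite ltr0_norm.
Qed.

Lemma norm_rV_coord (R : realType) n (x : 'rV[R]_n) i : `|x 0 i| <= `|x|.
Proof.
rewrite [leRHS]/Num.norm/= mx_normrE.
exact: (le_bigmax _ (fun ij => `|x ij.1 ij.2|) (0, i)).
Qed.

(** A monomial of positive degree vanishes at [a], and shrinking the cube gains at least one factor
    [s], as [s ^+ n <= s] for [n > 0]; the constant monomial cancels in the difference. The estimate
    is thus uniform in [alpha]. *)
Lemma monomial_at_scale (R : realType) (M : nat) (a x : 'rV[R]_M) (r s : R)
    (alpha : {ffun 'I_M -> nat}) :
  0 <= r -> 0 <= s <= 1 -> `|x - a| <= s * r ->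
  `|monomial_at a x alpha - monomial_at a a alpha| <=
  s * `|monomial_at a (a + const_mx r) alpha|.
Proof.
move=> r0 /andP[s0 s1] xa.
have xai i : `|(x - a) 0 i| <= s * r.
  by apply: le_trans xa; exact: norm_rV_coord.
have mr : `|monomial_at a (a + const_mx r) alpha| = \prod_i r ^+ alpha i.
  rewrite normr_prod; apply: eq_bigr => i _.
  by rewrite addrC addKr mxE normrX ger0_norm.
have [[i ai]|a0] := pselect (exists i, alpha i != 0%N).
  have -> : monomial_at a a alpha = 0.
    apply/eqP; rewrite prodf_seq_eq0; apply/hasP; exists i.
      exact: mem_index_enum.
    by rewrite subrr mxE expr0n (negbTE ai) eqxx.
  rewrite subr0 mr normr_prod (bigD1 i)//= [in leRHS](bigD1 i)//= mulrA.
  apply: ler_pM => //; first exact: prodr_ge0.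
    rewrite normrX (@le_trans _ _ ((s * r) ^+ alpha i))//.
      by rewrite lerXn2r ?nnegrE ?mulr_ge0.
    rewrite exprMn ler_wpM2r ?exprn_ge0//.
    rewrite -(prednK (_ : 0 < alpha i)%N) ?lt0n// exprS ler_piMr//.
    exact: exprn_ile1.
  apply: ler_prod => j _; rewrite normr_ge0/= normrX lerXn2r ?nnegrE//.
  by rewrite (le_trans (xai j))// ler_piMl.
have a0' i : alpha i = 0%N.
  by apply/eqP/negPn/negP => ai; apply: a0; exists i.
rewrite /monomial_at !big1 ?subrr ?normr0 ?mulr_ge0// => i _;
  by rewrite a0' expr0.
Qed.

(** [analytic_at] only provides pointwise convergence. Absolute convergence at the corner
    [a + const_mx r] of a cube dominates the series on the whole cube, and scaling the cube by [s]
    scales the bound on [G x - G a] by [s]. *)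
Lemma analytic_at_continuous (R : realType) (M N : nat)
    (G : 'rV[R]_M -> 'rV[R]_N) (a : 'rV[R]_M) :
  analytic_at G a -> {for a, continuous G}.
Proof.
move=> [c] /nbhs_ballP[e /= e0 eG].
have {}eG x : `|x - a| < e -> forall j,
    partial_sum (fun alpha => monomial_at a x alpha * c alpha 0 j) @ totally
      --> G x 0 j.
  move=> xa j; have /eG Gx : ball a e x by rewrite -ball_normE/= distrC.
  have -> : partial_sum (fun alpha => monomial_at a x alpha * c alpha 0 j) =
      (fun y : 'rV[R]_N => y 0 j) \o
      partial_sum (fun alpha => monomial_at a x alpha *: c alpha).
    apply/funext => A /=; rewrite /partial_sum summxE.
    by apply: eq_bigr => i _; rewrite mxE.
  exact: (cvg_comp _ _ Gx (@coord_continuous _ _ _ 0 j (G x))).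
pose r := e / 2.
have r0 : 0 < r by rewrite divr_gt0.
have re : r < e by rewrite /r ltr_pdivrMr// ltr_pMr// ltr1n.
have rp : `|(a + const_mx r) - a| < e.
  rewrite addrC addKr [ltLHS]/Num.norm/= mx_normrE.
  by apply/bigmax_ltP; split=> // ij _; rewrite mxE gtr0_norm.
have /choice[K KP] j : exists K, forall A : {fset {ffun 'I_M -> nat}},
    \sum_(i <- A) `|monomial_at a (a + const_mx r) i * c i 0 j| <= K.
  exact: totally_cvg_abs_bounded (eG _ rp j).
have GK s x j : 0 <= s <= 1 -> `|x - a| <= s * r ->
    `|G x 0 j - G a 0 j| <= s * K j.
  move=> s01 xa; have /andP[s0 s1] := s01.
  have xe : `|x - a| < e.
    by rewrite (le_lt_trans xa)// (le_lt_trans _ re)// ler_piMl// ltW.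
  have ae : `|a - a| < e by rewrite subrr normr0.
  apply: (cvgr_to_le (cvg_norm (cvgB (eG x xe j) (eG a ae j)))).
  near=> A.
  rewrite !fctE !partial_sumE -sumrB.
  rewrite (le_trans (ler_norm_sum _ _ _))//.
  rewrite (le_trans _ (ler_wpM2l s0 (KP j A)))// mulr_sumr.
  apply: ler_sum => i _; rewrite -mulrBl !normrM mulrA ler_wpM2r//.
  by apply: monomial_at_scale => //; exact: ltW.
apply/(@cvgrPdist_le _ _ _ _ (nbhs_filter a)) => t t0.
(* [K1] is positive and bounds every [K j]; [s] is capped at 1 for the use of [monomial_at_scale]
   and satisfies [s * K1 <= t]. *)
pose K1 := \sum_j `|K j| + 1.
have K10 : 0 < K1 by rewrite ltr_pwDr// sumr_ge0.
pose s := Num.min 1 (t / K1).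
have s0 : 0 < s by rewrite lt_min ltr01 divr_gt0.
near=> x.
have xa : `|x - a| <= s * r.
  rewrite distrC; near: x; apply: cvgr_dist_le; first exact: cvg_id.
  by rewrite mulr_gt0.
rewrite [leLHS]/Num.norm/= mx_normrE; apply/bigmax_leP; split; first exact: ltW.
move=> [i j] _ /=; rewrite ord1 !mxE distrC (le_trans (GK s x j _ xa))//.
  by rewrite ltW//= ge_min lexx.
have sK1 : s * K1 <= t by rewrite -ler_pdivlMr// ge_min lexx orbT.
rewrite (le_trans _ sK1)// ler_wpM2l ?(ltW s0)//.
rewrite (le_trans (ler_norm _))// /K1 (bigD1 j)//= -addrA lerDl.
by rewrite addr_ge0// sumr_ge0.
Unshelve. all: by end_near. Qed.

(** * Jacobian ranks *)

(** ['d f x] is chosen among the continuous linear maps that give a first-order expansion; if one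
    existed, the chosen one would have this property and [f] would be differentiable. Thanks to
    this, ranks of Jacobians can be compared without proving that analytic germs are
    differentiable. *)
Lemma diff_default (R : numFieldType) (V W : normedModType R) (f : V -> W) x :
  ~ differentiable f x -> 'd f x = point.
Proof.
move=> ndf; apply: xgetPN => df dfx; apply: ndf; apply/diffP.
apply: (@getPex _ (fun df : {linear V -> W} => continuous df /\
  forall y, f y = f (lim (nbhs x)) + df (y - lim (nbhs x))
                  +o_(y \near x) (y - lim (nbhs x)))).
by exists df.
Qed.

Lemma jacobian_comp (R : numFieldType) (m n p : nat)
    (f : 'rV[R]_m -> 'rV[R]_n) (g : 'rV[R]_n -> 'rV[R]_p) x :
  differentiable f x -> differentiable g (f x) ->
  'J (g \o f) x = 'J f x *m 'J g (f x).
Proof.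
move=> df dg; apply/row_matrixP => i.
by rewrite !rowE mulmxA !mul_rV_lin1 diff_comp.
Qed.

Lemma eq_lin1_mx (R : pzRingType) (m n : nat)
    (f g : {linear 'rV[R]_m -> 'rV[R]_n}) :
  f =1 g -> lin1_mx f = lin1_mx g.
Proof. by move=> fg; apply/matrixP => i j; rewrite !mxE fg. Qed.

(* When neither map is differentiable, both differentials take the same default
   value, so that the Jacobian matrices still agree. *)
Lemma rank_jacobian_conj (R : numFieldType) (m n : nat)
    (F1 F2 : 'rV[R]_m -> 'rV[R]_n) (f f' : 'rV[R]_m -> 'rV[R]_m)
    (g g' : 'rV[R]_n -> 'rV[R]_n) (x y : 'rV[R]_m) :
  f x = y -> f' y = x ->
  differentiable f x -> differentiable f' y ->
  differentiable g (F1 y) -> differentiable g' (F2 x) ->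
  {near x, F2 =1 g \o F1 \o f} -> {near y, F1 =1 g' \o F2 \o f'} ->
  (\rank ('J F1 y) <= \rank ('J F2 x))%N.
Proof.
move=> fx f'y df df' dg dg' E2 E1.
have [dF2|ndF2] := pselect (differentiable F2 x).
  have dF2' : differentiable (F2 \o f') y.
    by apply: differentiable_comp => //; rewrite f'y.
  have dF1 : differentiable (g' \o F2 \o f') y.
    by apply: (differentiable_comp dF2'); rewrite /= f'y.
  have E1' : {near y, (g' \o F2 \o f') =1 F1}.
    by apply: filterS E1 => z ->.
  have -> : 'J F1 y = 'J (g' \o (F2 \o f')) y.
    have [_ dE] := near_eq_differentiable E1' dF1.
    exact/eq_lin1_mx/funeqP.
  rewrite jacobian_comp//=; last by rewrite f'y.
  rewrite jacobian_comp//= f'y//.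
  exact: leq_trans (mxrankM_maxl _ _) (mxrankM_maxr _ _).
suff ndF1 : ~ differentiable F1 y by rewrite /jacobian !diff_default.
move=> dF1; apply: ndF2.
have dF : differentiable (g \o F1 \o f) x.
  apply: differentiable_comp => //=; rewrite fx.
  exact: differentiable_comp.
have E2' : {near x, (g \o F1 \o f) =1 F2} by apply: filterS E2 => z ->.
by have [] := near_eq_differentiable E2' dF.
Qed.

Lemma differentiable_map_with (R : realType) (M N : nat)
    (G : 'rV[R]_M -> 'rV[R]_N) (rho : 'rV[R]_M -> R) x :
  differentiable G x -> differentiable rho x ->
  differentiable (map_with G rho) x.
Proof.
move=> dG drho; apply: differentiable_rV => j.
case: (split_ordP j) => k jk.
  have -> : (fun y => map_with G rho y 0 j) = (fun u : 'rV_N => u 0 k) \o G.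
    by apply/funext => y; rewrite /map_with jk row_mxEl.
  by apply: differentiable_comp => //; exact: differentiable_coord.
have -> : (fun y => map_with G rho y 0 j) = rho.
  by apply/funext => y; rewrite /map_with jk row_mxEr mxE !ord1 eqxx.
exact: drho.
Qed.

(** * Diffeomorphism germs and proper functions *)

Lemma open_setI_preimage (T S : topologicalType) (f : T -> S) A B :
  open A -> (forall x, A x -> {for x, continuous f}) -> open B ->
  open (A `&` f @^-1` B).
Proof.
move=> oA cf oB; rewrite openE => x [Ax Bfx]; apply: filterI.
  exact: open_nbhs_nbhs.
by apply: (cf x Ax); exact: open_nbhs_nbhs.
Qed.

Section diffeo_between.
Context {R : realType} {V : normedModType R}.

(** Fixed domains replace the germ-wise inverse identities of [diffeo_germ], so that later arguments
    can go pointwise and away from the origin. *)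
Definition diffeo_between (A B : set V) (f f' : V -> V) : Prop :=
  [/\ open A, open B, smooth_on A f, smooth_on B f' &
    (forall x, A x -> B (f x) /\ f' (f x) = x) /\
    (forall y, B y -> A (f' y) /\ f (f' y) = y)].

Lemma smooth_on_continuous (W : normedModType R) (A : set V) (f : V -> W) x :
  smooth_on A f -> A x -> {for x, continuous f}.
Proof. by move=> /(_ 0%N); exact. Qed.

Lemma smooth_on_differentiable (W : normedModType R) (A : set V) (f : V -> W)
    x :
  smooth_on A f -> A x -> differentiable f x.
Proof. by move=> /(_ 1%N)[df _] /df. Qed.

Lemma diffeo_germ_between (f : V -> V) : diffeo_germ f ->
  exists A B f', [/\ diffeo_between A B f f', A 0, B 0 & f' 0 = 0].
Proof.
move=> [f0 [A0 [oA0 A00 sf]] [f' [[B0 [oB0 B00 sf']] K K']]].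
have f'0 : f' 0 = 0 by rewrite -[in LHS]f0 (nbhs_singleton K).
pose A1 := A0 `&` [set x | f' (f x) = x]°.
pose B1 := B0 `&` [set y | f (f' y) = y]°.
have oA1 : open A1 by apply: openI => //; exact: open_interior.
have oB1 : open B1 by apply: openI => //; exact: open_interior.
have A1K x : A1 x -> f' (f x) = x by case=> _ /interior_subset.
have B1K y : B1 y -> f (f' y) = y by case=> _ /interior_subset.
have sfA : smooth_on A1 f by move=> k; apply: Ck_on_sub (sf k) => x [].
have sfB : smooth_on B1 f' by move=> k; apply: Ck_on_sub (sf' k) => x [].
(* Trimming each domain by the preimage of the other makes the two maps exchange them: if [x] is in
   [A1] and [f x] in [B1], then [f' (f x) = x] is in [A1]. *)
exists (A1 `&` f @^-1` B1), (B1 `&` f' @^-1` A1), f'; split => //.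
- split.
  + by apply: open_setI_preimage => // x; exact: smooth_on_continuous.
  + by apply: open_setI_preimage => // x; exact: smooth_on_continuous.
  + by move=> k; apply: Ck_on_sub (sfA k) => x [].
  + by move=> k; apply: Ck_on_sub (sfB k) => x [].
  + by split=> [x [Ax Bfx]|y [By Afy]]; rewrite /= ?A1K ?B1K//.
- by split; [split|rewrite /= f0; split].
- by split; [split|rewrite /= f'0; split].
Qed.

End diffeo_between.

(** By properness, the points of [U] outside [B] with [rho <= 1] form a compact set, which misses 0.
    The minimum of [rho] on it is positive and serves as [e], or 1 does if the set is empty. *)
Lemma proper_function_sublevel (R : realType) (M : nat) (U B : set 'rV[R]_M)
    (rho : 'rV[R]_M -> R) : proper_function U rho -> open B -> B 0 ->
  exists2 e, 0 < e & forall x, U x -> rho x < e -> B x.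
Proof.
move=> [[oU U0] srho rho_ge0 rhoK rho_eq0] oB B0.
pose C := (U `&` rho @^-1` `[0, 1]) `\` B.
have cC : compact C.
  apply: compact_closedI; last exact: open_closedC.
  apply: rhoK; last exact: segment_compact.
  by move=> t /=; rewrite in_itv/= => /andP[].
have CP x : U x -> rho x <= 1 -> ~ B x -> C x.
  by move=> Ux x1 nBx; split=> //; split=> //=; rewrite in_itv/= rho_ge0.
have [C_eq0|/set0P C0] := eqVneq C set0.
  exists 1 => // x Ux x1; apply: contrapT => nBx.
  by have := CP _ Ux (ltW x1) nBx; rewrite C_eq0.
have [|c /set_mem[[Uc c1] nBc] cmin] := @compact_EVT_min _ _ rho _ C0 cC.
  apply: continuous_in_subspaceT => x /set_mem[[Ux _] _].
  exact: smooth_on_continuous srho Ux.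
have rc0 : 0 < rho c.
  rewrite lt_def rho_ge0// andbT; apply/eqP => /(rho_eq0 _ Uc).1 c0.
  by apply: nBc; rewrite c0.
exists (rho c) => // x Ux xc; apply: contrapT => nBx.
have /cmin : x \in C.
  apply/mem_set/CP => //; apply: ltW; apply: lt_le_trans xc _.
  by move: c1; rewrite /= in_itv/= => /andP[].
by rewrite leNgt xc.
Qed.

Section proper_pullback.
Context {R : realType} {M : nat}.
Variables (A B U : set 'rV[R]_M) (f f' : 'rV[R]_M -> 'rV[R]_M).
Variables (rho : 'rV[R]_M -> R) (e : R).
Hypotheses (ff' : diffeo_between A B f f') (A0 : A 0) (f0 : f 0 = 0).
Hypotheses (prho : proper_function U rho) (e0 : 0 < e).
Hypothesis Ue : forall x, U x -> rho x < e -> B x.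

Definition pullback_dom : set 'rV[R]_M :=
  A `&` f @^-1` (U `&` rho @^-1` [set t | t < e]).

(* The factor [(e - rho)^-1] makes the function blow up at the boundary of the
   sublevel set, which restores properness. *)
Definition pullback_fun (x : 'rV[R]_M) : R := rho (f x) * (e - rho (f x))^-1.

Lemma pullback_domP x : pullback_dom x ->
  [/\ A x, U (f x), 0 <= rho (f x) & rho (f x) < e].
Proof. by case: prho => _ _ p _ _ [Ax [Ufx /= xe]]; split=> //; exact: p. Qed.

(** The map [s |-> e * (s / (1 + s))] inverts [t |-> t / (e - t)], a bijection from [[0, e[] onto
    [[0, +oo[]. This serves both for properness and for inverting the change of coordinates on the
    target. *)
Lemma pullback_funK x : pullback_dom x ->
  e * (pullback_fun x / (1 + pullback_fun x)) = rho (f x).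
Proof.
move=> /pullback_domP[_ _ x0 xe]; rewrite /pullback_fun; set t := rho (f x).
have et : e - t != 0 by rewrite subr_eq0 gt_eqF.
have -> : 1 + t / (e - t) = e / (e - t).
  by rewrite -[X in X + _](divff et) -mulrDl subrK.
by rewrite invf_div [X in e * X]mulrA divfK// mulrCA divff ?mulr1 ?gt_eqF.
Qed.

Lemma pullback_fun_ge0 x : pullback_dom x -> 0 <= pullback_fun x.
Proof.
by move=> /pullback_domP[_ _ x0 xe]; rewrite divr_ge0// subr_ge0 ltW.
Qed.

Lemma open_pullback_dom : open pullback_dom.
Proof.
case: ff' => oA _ sf _ _; case: prho => [[oU _] srho _ _ _].
apply: (open_setI_preimage oA); first by move=> x; exact: smooth_on_continuous.
apply: (open_setI_preimage oU); first by move=> x; exact: smooth_on_continuous.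
exact: open_lt.
Qed.

Lemma proper_function_pullback : proper_function pullback_dom pullback_fun.
Proof.
have oD := open_pullback_dom.
case: ff' => oA oB sf sf' [fK f'K].
case: prho => [[oU U0] srho rho_ge0 rhoK rho_eq0].
have rho0 : rho 0 = 0 by apply/rho_eq0.
split.
- by split=> //; split=> //; rewrite /= f0; split=> //=; rewrite rho0.
- move=> k.
  have Crf : Ck_on k pullback_dom (rho \o f).
    apply: Ck_on_comp (srho k) => // [x [_ []]//|].
    by apply: Ck_on_sub (sf k) => x [].
  apply: Ck_onM => //; apply: Ck_onV => // [x /pullback_domP[_ _ _ xe]|].
    by rewrite subr_eq0 gt_eqF.
  have CN : Ck_on k pullback_dom (fun=> -1 : R) by exact: Ck_on_cst.
  have Ce : Ck_on k pullback_dom (fun=> e : R) by exact: Ck_on_cst.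
  apply: Ck_on_eq (Ck_onD oD Ce (Ck_onM oD CN Crf)) => // x _.
  by rewrite mulN1r.
- exact: pullback_fun_ge0.
(* The preimage of [K] is obtained by pushing [K] forward by [g], pulling back by the proper [rho],
   and pushing forward by [f']; each operation preserves compactness. *)
- move=> K K0 cK.
  pose g (s : R) := e * (s / (1 + s)).
  have gK s : 0 <= s -> [/\ 0 <= g s, g s < e & g s * (e - g s)^-1 = s].
    move=> s0; have s1 : 0 < 1 + s by rewrite ltr_wpDr.
    have s1' : 1 + s != 0 by rewrite gt_eqF.
    have eg : e - g s = e / (1 + s).
      rewrite /g -[X in X - _]mulr1 -mulrBr -[X in X - _](divff s1') -mulrBl.
      by rewrite addrK mul1r.
    split.
    + by rewrite mulr_ge0 ?divr_ge0// ltW.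
    + by rewrite -subr_gt0 eg divr_gt0.
    + rewrite eg /g invf_div [_ / e]mulrC mulrACA divff ?gt_eqF// mul1r.
      by rewrite divfK.
  have cgK : compact (g @` K).
    apply: continuous_compact cK.
    apply: continuous_in_subspaceT => s /set_mem Ks.
    apply: cvgM; first exact: cvg_cst.
    apply: cvgM; first exact: cvg_id.
    apply: cvgV; first by rewrite gt_eqF// ltr_wpDr// K0.
    by apply: cvgD; [exact: cvg_cst|exact: cvg_id].
  have gK0 : g @` K `<=` [set t | 0 <= t].
    by move=> _ [s Ks <-]; have [] := gK s (K0 _ Ks).
  (* On [K] the values of [g] are below [e], so [Ue] puts these points in [B], where [f'] is smooth
     and inverts [f]. *)
  have B' y : U y -> (g @` K) (rho y) -> B y /\ rho y < e.
    by move=> Uy [s /K0/gK[_ ge _] gs]; rewrite gs in ge; split=> //; exact: Ue.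
  have -> : pullback_dom `&` pullback_fun @^-1` K =
      f' @` (U `&` rho @^-1` (g @` K)).
    apply/seteqP; split=> [x [Dx Kx]|_ [y [Uy gy] <-]].
      have [Ax Ufx x0 xe] := pullback_domP Dx.
      exists (f x); last by have [] := fK _ Ax.
      by split=> //; exists (pullback_fun x) => //; exact: pullback_funK.
    have [By ye] := B' _ Uy gy; have [Af'y ff'y] := f'K _ By.
    split; first by split=> //; rewrite /= ff'y.
    rewrite /= /pullback_fun ff'y; move: gy => [s Ks <-].
    by have [_ _ ->] := gK s (K0 _ Ks).
  apply: continuous_compact; last exact: rhoK.
  apply: continuous_in_subspaceT => y /set_mem[Uy /(B' _ Uy)[By _]].
  exact: smooth_on_continuous sf' By.
- move=> x /[dup] Dx /pullback_domP[Ax Ufx x0 xe].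
  rewrite /pullback_fun; split=> [/eqP|->]; last by rewrite f0 rho0 mul0r.
  rewrite mulf_eq0 invr_eq0 subr_eq0 [e == _]gt_eqF// orbF => /eqP.
  move=> /(rho_eq0 _ Ufx).1 fx0; rewrite -[x](fK _ Ax).2 fx0 -[in LHS]f0.
  by rewrite (fK _ A0).2.
Qed.

End proper_pullback.

(** * Singular sets under changes of coordinates *)

(* [map_with] is reused to act by [psi] on the first [N] coordinates of the
   target of [map_with G rho] and by [h] on the last one. *)
Definition target_map (R : realType) (N : nat) (psi : 'rV[R]_N -> 'rV[R]_N)
    (h : R -> R) : 'rV[R]_(N + 1) -> 'rV[R]_(N + 1) :=
  map_with (psi \o lsubmx) (h \o (fun w => rsubmx w 0 0)).

Lemma target_mapE (R : realType) (M N : nat) (psi : 'rV[R]_N -> 'rV[R]_N)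
    (h : R -> R) (G : 'rV[R]_M -> 'rV[R]_N) (rho : 'rV[R]_M -> R) x :
  target_map psi h (map_with G rho x) = row_mx (psi (G x)) (h (rho x))%:M.
Proof.
by rewrite /target_map /map_with /= row_mxKl row_mxKr mxE eqxx mulr1n.
Qed.

Lemma differentiable_target_map (R : realType) (M N : nat)
    (psi : 'rV[R]_N -> 'rV[R]_N) (h : R -> R) (G : 'rV[R]_M -> 'rV[R]_N)
    (rho : 'rV[R]_M -> R) x :
  differentiable psi (G x) -> differentiable h (rho x) ->
  differentiable (target_map psi h) (map_with G rho x).
Proof.
move=> dpsi dh; apply: differentiable_map_with.
  apply: (@differentiable_comp _ _ _ _ (lsubmx : 'rV[R]_(N + 1) -> _) psi).
    exact: differentiable_lsubmx.
  by rewrite /map_with row_mxKl.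
apply: (@differentiable_comp _ _ _ _
  ((fun w : 'rV[R]_1 => w 0 0) \o (rsubmx : 'rV[R]_(N + 1) -> _)) h).
  apply: differentiable_comp; first exact: differentiable_rsubmx.
  exact: differentiable_coord.
by rewrite /map_with /= row_mxKr mxE eqxx mulr1n.
Qed.

Section milnor_set.
Context {R : realType} {M N : nat}.
Variables (G1 G2 : 'rV[R]_M -> 'rV[R]_N).
Variables (A B U : set 'rV[R]_M) (phi phi' : 'rV[R]_M -> 'rV[R]_M).
Variables (C D : set 'rV[R]_N) (psi psi' : 'rV[R]_N -> 'rV[R]_N).
Variables (rho : 'rV[R]_M -> R) (e : R).
Hypotheses (hphi : diffeo_between A B phi phi').
Hypotheses (hpsi : diffeo_between C D psi psi').
Hypotheses (prho : proper_function U rho) (e0 : 0 < e).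
Let rho2 := pullback_fun phi rho e.

(** On [O], [map_with G2 rho2] is [map_with G1 rho] preceded by [phi] and followed by a change of
    coordinates on the target. Both changes can be undone locally, so [rank_jacobian_conj] compares
    the ranks. *)
Lemma milnor_set_pullback (O : set 'rV[R]_M) : open O ->
  O `<=` pullback_dom A U phi rho e ->
  (forall x, O x -> C (G1 (phi x)) /\ G2 x = psi (G1 (phi x))) ->
  forall x, O x -> milnor_set G2 rho2 x -> milnor_set G1 rho (phi x).
Proof.
move=> oO OD OG x Ox; rewrite /milnor_set /=; apply: leq_ltn_trans.
have [oA oB sphi sphi' [phiK phi'K]] := hphi.
have [oC oD spsi spsi' [psiK psi'K]] := hpsi.
have [Ax Uy y0 ye] := pullback_domP prho (OD _ Ox).
have [By phi'y] := phiK _ Ax.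
have [Cy G2x] := OG _ Ox.
(* [h] is the reparametrisation inside [pullback_fun], and [h'] its inverse from [pullback_funK]. *)
pose h (t : R) := t * (e - t)^-1.
pose h' (s : R) := e * (s * (1 + s)^-1).
apply: (@rank_jacobian_conj _ _ _ _ _ phi phi' (target_map psi h)
  (target_map psi' h')) => //.
- exact: smooth_on_differentiable sphi Ax.
- exact: smooth_on_differentiable sphi' By.
- apply: differentiable_target_map.
    exact: smooth_on_differentiable spsi Cy.
  apply: differentiableM => //; apply: differentiableV.
    by apply: differentiableB.
  by rewrite subr_eq0 gt_eqF.
- apply: differentiable_target_map.
    rewrite G2x; exact: smooth_on_differentiable spsi' (psiK _ Cy).1.
  apply: differentiableM => //; apply: differentiableM => //.
  apply: differentiableV; first exact: differentiableD.
  by rewrite gt_eqF// ltr_wpDr// (pullback_fun_ge0 prho (OD _ Ox)).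
- near=> z; have Oz : O z by near: z; exact: open_nbhs_nbhs.
  rewrite /= target_mapE /map_with.
  by have [_ ->] := OG _ Oz.
(* The inverse relation is needed near [phi x]: continuity of [phi'] there brings [phi' w] into [O],
   where [G2] factors through [psi] and [psi'] undoes [psi]. *)
- near=> w.
  have Ow : O (phi' w).
    near: w; apply: (smooth_on_continuous sphi' By).
    by rewrite phi'y; exact: open_nbhs_nbhs.
  have Bw : B w by near: w; exact: open_nbhs_nbhs.
  have [_ phiw] := phi'K _ Bw; have [Cw G2w] := OG _ Ow.
  rewrite /= target_mapE G2w phiw in Cw *.
  rewrite (psiK _ Cw).2 /h' (pullback_funK prho e0 (OD _ Ow)).
  by rewrite phiw.
Unshelve. all: by end_near. Qed.

End milnor_set.

(** * Transport of tameness along the equivalence *)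

Theorem proposition3p7 (R : realType) (M N : nat)
  (hN : (2 <= N)%N) (hMN : (N <= M)%N)
  (G1 G2 : 'rV[R]_M -> 'rV[R]_N)
  (hG1 : analytic_map_germ G1) (hG2 : analytic_map_germ G2)
  (nc1 : ~ constant_germ G1) (nc2 : ~ constant_germ G2)
  (hA : smooth_A_equivalent G1 G2)
  (U1 : set 'rV[R]_M) (rho1 : 'rV[R]_M -> R)
  (hrho1 : proper_function U1 rho1) (htame : tame G1 rho1) :
  exists (U2 : set 'rV[R]_M) (rho2 : 'rV[R]_M -> R),
    proper_function U2 rho2 /\ tame G2 rho2.
Proof.
have [phi [psi [dphi dpsi G2E]]] := hA.
have [phi0 _ _] := dphi; have [psi0 _ _] := dpsi.
have [A [B [phi' [hphi A0 B0 phi'0]]]] := diffeo_germ_between dphi.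
have [C [D [psi' [hpsi C0 _ psi'0]]]] := diffeo_germ_between dpsi.
have [oA oB sphi sphi' [phiK phi'K]] := hphi.
have [oC oD spsi spsi' [psiK psi'K]] := hpsi.
have [e e0 Ue] := proper_function_sublevel hrho1 oB B0.
pose U2 := pullback_dom A U1 phi rho1 e.
have oU2 : open U2 by exact: open_pullback_dom hphi hrho1.
have prho2 := proper_function_pullback hphi A0 phi0 hrho1 e0 Ue.
exists U2, (pullback_fun phi rho1 e); split => //.
have cphi : {for 0, continuous phi} := smooth_on_continuous sphi A0.
have [G10 aG1] := hG1.
have cG1 : {for 0, continuous G1}.
  exact: analytic_at_continuous (nbhs_singleton aG1).
(* On [O] the factorisation of [G2] is available and [psi] is only evaluated in [C], where it is
   injective. Continuity of [phi] and [G1] at 0 puts the origin in the interior. *)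
pose O := U2 `&` [set x | C (G1 (phi x)) /\ G2 x = psi (G1 (phi x))]°.
have oO : open O by apply: openI => //; exact: open_interior.
have O0 : O 0.
  have [[_ U20] _ _ _ _] := prho2; split => //.
  apply: filterI => //.
  apply: (cphi [set y | C (G1 y)]); rewrite phi0; apply: (cG1 C); rewrite G10.
  exact: open_nbhs_nbhs.
have OG x : O x -> C (G1 (phi x)) /\ G2 x = psi (G1 (phi x)).
  by case=> _ /interior_subset.
have OU2 : O `<=` U2 by move=> x [].
have OA x : O x -> A x by move=> /OU2[].
have zE x : O x -> zero_locus G2 x <-> zero_locus G1 (phi x).
  move=> Ox; have [Cx G2x] := OG x Ox; rewrite /zero_locus/= G2x.
  split=> [z|->]; last exact: psi0.
  by rewrite -(psiK _ Cx).2 z psi'0.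
(* Naming the property that [htame] gives near 0 lets continuity of [phi] at 0 pull it back to
   points [x] near 0. *)
pose T := [set y | (closure (milnor_set G1 rho1 `\` zero_locus G1) `&`
  zero_locus G1) y -> y = 0].
near=> x; move=> [clx zx].
have Ox : O x by near: x; exact: open_nbhs_nbhs.
suff phix0 : phi x = 0 by rewrite -(phiK _ (OA _ Ox)).2 phix0 phi'0.
have tx : T (phi x) by near: x; apply: (cphi T); rewrite phi0; exact: htame.
apply: tx; split; last exact/(zE _ Ox).
(* A neighbourhood [W] of [phi x] pulls back to one of [x] inside [O]. It contains a point [z]
   singular for [G2] and its proper function but off the zero locus of [G2]; then [phi z] is the
   required point of [W]. *)
move=> W nW.
have nWO : nbhs x (O `&` phi @^-1` W).
  apply: filterI; first exact: open_nbhs_nbhs.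
  exact: (smooth_on_continuous sphi (OA _ Ox)).
have [z [[Mz zz] [Oz Wz]]] := clx _ nWO.
exists (phi z); split; last exact: Wz.
split; last by move=> /(zE _ Oz).
exact: (milnor_set_pullback hphi hpsi hrho1 e0 oO OU2 OG Oz Mz).
Unshelve. all: by end_near. Qed.
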